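(* Let $x=(x_n)_{n\ge1}$, $x_n\ge0$, be finitely supported and suppose that $$(nx_n-mx_m)(n^2x_n-m^2x_m)\ge0\qquad(m,n\ge1).\tag{*}$$ A sufficient condition for ( * ) is $(n+1)^2x_{n+1}\le n^2x_n$ for all $n\ge1$. Then $$\mathcal C(x)\le2AE_3.$$ More precisely, for every $k\ge1$ the quantity $Q_k$ (defined in the context) satisfies $$Q_k=\sum_{n\ge1}\bigl(nx_n-(n+k)x_{n+k}\bigr)\bigl(n^2x_n-(n+k)^2x_{n+k}\bigr)+\sum_{j=1}^kj^3x_j^2\ge0.$$ The conclusion extends to every infinite nonnegative sequence satisfying ( * ) for which $A<\infty$ and $E_3<\infty$. The constant $2$ in $\mathcal C(x)\le2AE_3$ is sharp even within the class of sequences satisfying ( * ). Consequently, for every $x$ in this class, the fully anticoherent spectrum with positive-frequency coefficients $r_n=-x_n$ ($n\ge1$) and mean $m$ has nonnegative strong bracket whenever $m\ge2A$.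
   Context: For a nonnegative sequence $x=(x_n)_{n\ge1}$, $$A=\sum_{n\ge1}x_n,\quad E_3=\sum_{n\ge1}n^3x_n^2,\quad \mathcal C(x)=\sum_{a,b\ge1}(a+b)(a^2+ab+b^2)x_ax_bx_{a+b}.$$ With $a_n=nx_n$ put $$Q_k=2\sum_{n\ge1}na_n^2-\sum_{n\ge1}(2n+k)a_na_{n+k};$$ one has $AE_3-\frac12\mathcal C(x)=\frac12\sum_{k\ge1}x_kQ_k$. The strong bracket of a real function $\rho(s)=m+\sum_{n\ne0}r_ne^{ins}$, $r_{-n}=\overline{r_n}$, is $$\mathfrak H(\rho)=8\pi\Bigl[m\sum_{n\ge1}n^3|r_n|^2+\sum_{a,b\ge1}(a+b)(a^2+ab+b^2)\,\mathrm{Re}(r_ar_b\overline{r_{a+b}})\Bigr],$$ which for smooth $\rho$ equals $2\int_{\mathbb T}\rho(\Lambda\rho_s)\rho_s\,ds+\int_{\mathbb T}(\Lambda\rho)\rho_s^2\,ds$, where $\widehat{\Lambda f}(k)=|k|\hat f(k)$ on $\mathbb T=\mathbb R/2\pi\mathbb Z$. For $r_n=-x_n$ it equals $8\pi(mE_3-\mathcal C(x))$. *)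

(* Defs.v *)
From mathcomp Require Import all_boot all_order all_algebra.
From mathcomp Require Import all_classical all_reals all_analysis.
From mathcomp Require Export complex.

Set Implicit Arguments.
Unset Strict Implicit.
Unset Printing Implicit Defensive.

Import Order.TTheory GRing.Theory Num.Theory.

Local Open Scope classical_set_scope.
Local Open Scope ring_scope.

(* A sequence (x_n)_{n >= 1} is a function x : nat -> R; the value x 0 is never
   used.  All sums take values in the extended reals. *)

(* Sum of a real family over the pairs (a, b) with a, b >= 1, as the difference
   of the unordered sums of its positive and negative parts: it is the usual sum
   when the family is absolutely summable, and the plain unordered sum (possibly
   +oo) when the family is nonnegative.  MathComp-Analysis has oo - oo = -oo. *)
Definition dsum (R : realType) (f : nat * nat -> R) : \bar R :=
  let D := [set p : nat * nat | (0 < p.1)%N /\ (0 < p.2)%N] in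
  (\esum_(p in D) (f^\+%R p)%:E - \esum_(p in D) (f^\-%R p)%:E)%E.

Definition kern (R : realType) (a b : nat) : R :=
  (a + b)%:R * (a ^ 2 + a * b + b ^ 2)%:R.

Definition seqA (R : realType) (x : nat -> R) : \bar R :=
  (\sum_(1 <= n <oo) (x n)%:E)%E.

Definition seqE3 (R : realType) (x : nat -> R) : \bar R :=
  (\sum_(1 <= n <oo) (n%:R ^+ 3 * x n ^+ 2)%:E)%E.

Definition seqC (R : realType) (x : nat -> R) : \bar R :=
  dsum (fun p => kern R p.1 p.2 * x p.1 * x p.2 * x (p.1 + p.2)%N).

Definition seqQ (R : realType) (x : nat -> R) (k : nat) : \bar R :=
  let a n := n%:R * x n in
  (2%:E * (\sum_(1 <= n <oo) (n%:R * a n ^+ 2)%:E)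
   - \sum_(1 <= n <oo) ((2 * n + k)%:R * a n * a (n + k)%N)%:E)%E.

Definition nonneg_seq (R : realType) (x : nat -> R) : Prop :=
  forall n, (0 < n)%N -> 0 <= x n.

Definition finitely_supported (R : realType) (x : nat -> R) : Prop :=
  exists N, forall n, (N <= n)%N -> x n = 0.

Definition star (R : realType) (x : nat -> R) : Prop :=
  forall m n, (0 < m)%N -> (0 < n)%N ->
    0 <= (n%:R * x n - m%:R * x m) * (n%:R ^+ 2 * x n - m%:R ^+ 2 * x m).

Definition sosQ (R : realType) (x : nat -> R) (k : nat) : \bar R :=
  (\sum_(1 <= n <oo)
     ((n%:R * x n - (n + k)%:R * x (n + k)%N)
      * (n%:R ^+ 2 * x n - (n + k)%:R ^+ 2 * x (n + k)%N))%:E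
   + \sum_(1 <= j < k.+1) (j%:R ^+ 3 * x j ^+ 2)%:E)%E.

(* Fourier coefficients r_n, n in Z, of a real function on R / 2 pi Z. *)
Definition real_spectrum (R : realType) (r : int -> R[i]) : Prop :=
  forall n : int, r (- n) = conjc (r n).

(* Strong bracket of rho(s) = sum_{n in Z} r_n e^{ins}; the mean m is r_0. *)
Definition strong_bracket (R : realType) (r : int -> R[i]) : \bar R :=
  let triple (p : nat * nat) : R :=
    kern R p.1 p.2 *
    complex.Re (r p.1%:Z * r p.2%:Z * conjc (r (p.1 + p.2)%N%:Z)) in
  ((8 * pi)%:E *
   ((complex.Re (r 0))%:E
      * (\sum_(1 <= n <oo)
           (n%:R ^+ 3 * ComplexField.Normc.normc (r n%:Z) ^+ 2)%:E)
    + dsum triple))%E.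

(* The fully anticoherent spectrum: mean m and r_n = - x_n for n >= 1. *)
Definition anticoherent (R : realType) (m : R) (x : nat -> R)
    (r : int -> R[i]) : Prop :=
  [/\ real_spectrum r, r 0 = (m%:C)%C &
      forall n : nat, (0 < n)%N -> r n%:Z = ((- x n)%:C)%C].

(* Main.v *)
Require Import Defs.
From mathcomp Require Import all_boot all_order all_algebra.
From mathcomp Require Import all_classical all_reals all_analysis.
From mathcomp Require Import ring lra zify.

Import Order.TTheory GRing.Theory Num.Theory.

Local Open Scope ring_scope.

(** Write a_n = n x_n.  Multiplying out,
      (a_n - a_(n+k)) (n a_n - (n+k) a_(n+k))
        = n a_n^2 + (n+k) a_(n+k)^2 - (2n+k) a_n a_(n+k),
    and n a_n^2 = n^3 x_n^2 is the general term of E_3.  Summed over n >= 1,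
    the shifted copy of E_3 lacks exactly its first k terms, hence
      SOS_k + head_k + cross_k = 2 E_3,
    where cross_k is the sum of (2n+k) a_n a_(n+k) and Q_k = 2 E_3 - cross_k
    ([sosQ_cross]).  Under (star) the summands of SOS_k are nonnegative; so
    cross_k is finite when E_3 is, Q_k = SOS_k + head_k is nonnegative, and
    cross_k <= 2 E_3.  Keeping every sum nonnegative, this balance holds in
    the extended reals, and no rearrangement has to be justified.

    The bound on the cubic form follows because
      C(x) = sum over k of x_k cross_k                    ([seqC_cross]):
    both sides are sums over pairs (k, n), and averaging the right-hand
    weight n (n+k) (2n+k) over the two orders of the pair gives the kernel
    (n+k) (n^2 + nk + k^2).
    Therefore C(x) <= 2 A E_3, and the strong bracket of the anticoherent
    spectrum, 8 pi (m E_3 - C(x)), is nonnegative once m >= 2A.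

    The constant 2 is approached by x_n = 1/n^2 truncated at N, for which
    n^2 x_n is nonincreasing and E_3 is the harmonic number H_N.  There
    (2n+k) a_n a_(n+k) >= 2/(n+k), so cross_k >= 2 (H_N - H_k), and
      C(x) >= 2 A H_N - 2 sum over k of H_k / k^2 >= 2 A E_3 - 8.
    Since A >= 1 and H_N is unbounded, the constant term is negligible. *)

(** * Sums of nonnegative terms over positive integers and pairs *)

Definition posn : set nat := [set n | (0 < n)%N]%classic.

(** Unordered sums only ask for a sign on the summation set, whereas several
    facts on series want it for every index; here x 0 is unconstrained. *)
Lemma pos_esum {R : realType} (f : nat -> \bar R) :
  (forall n, (0 < n)%N -> (0 <= f n)%E) ->
  (\sum_(1 <= n <oo) f n = \esum_(n in posn) f n)%E.
Proof. by move=> f0; rewrite eseries_cond /= nneseries_esum. Qed.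

Lemma pos_esumZl {R : realType} (c : R) (f : nat -> \bar R) :
  0 <= c -> (forall n, (0 < n)%N -> (0 <= f n)%E) ->
  (\esum_(n in posn) (c%:E * f n) = c%:E * \esum_(n in posn) f n)%E.
Proof.
move=> c0 f0; rewrite -!nneseries_esum//; first exact: nneseriesZl.
by move=> n n0; rewrite mule_ge0 ?lee_fin ?f0.
Qed.

Lemma pos_esum_split {R : realType} (f : nat -> R) (k : nat) :
  (forall n, 0 <= f n) ->
  (\esum_(n in posn) (f n)%:E =
   \sum_(1 <= j < k.+1) (f j)%:E + \esum_(n in posn) (f (n + k)%N)%:E)%E.
Proof.
move=> f0; have fe n : (0 <= (f n)%:E)%E by rewrite lee_fin.
rewrite -!pos_esum// (nneseries_split 1 k)//; congr (_ + _)%E.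
rewrite -(@nneseries_addn _ (fun n => (f n)%:E))//.
rewrite -(@nneseries_addn _ (fun n => (f (n + k)%N)%:E))//.
by apply: eq_eseriesr => i _; rewrite addnA.
Qed.

Lemma eseries1_finite_support {R : realType} (f : nat -> R) (N : nat) :
  (forall n, (0 < n)%N -> 0 <= f n) -> (forall n, (N < n)%N -> f n = 0) ->
  (\sum_(1 <= n <oo) (f n)%:E = (\sum_(1 <= n < N.+1) f n)%:E)%E.
Proof.
move=> f0 fN; rewrite (nneseries_split 1 N); last first.
  by move=> n n0; rewrite lee_fin f0.
rewrite [X in (_ + X)%E]eseries0 ?adde0 ?add1n ?sumEFin//.
by move=> n Nn _; rewrite fN.
Qed.

Definition pospair : set (nat * nat) := [set p | (0 < p.1)%N /\ (0 < p.2)%N]%classic.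

Lemma dsum_ge0 {R : realType} (f : nat * nat -> R) :
  (forall p, pospair p -> 0 <= f p) ->
  dsum f = (\esum_(p in pospair) (f p)%:E)%E.
Proof.
move=> f0; rewrite /dsum [X in (_ - X)%E]esum1 ?sube0; last first.
  by move=> p /f0 fp; rewrite /funrneg /= (elimT max_idPr _)// oppr_le0.
by apply: eq_esum => p /f0 fp; rewrite /funrpos /= (elimT max_idPl _).
Qed.

Lemma dsum_le0 {R : realType} (f : nat * nat -> R) :
  (forall p, pospair p -> f p <= 0) ->
  dsum f = (- dsum (fun p => - f p)%R)%E.
Proof.
move=> f0; rewrite (dsum_ge0 (fun p => - f p)); last first.
  by move=> p /f0; rewrite oppr_ge0.
rewrite /dsum esum1 ?add0e; last first.
  by move=> p /f0 fp; rewrite /funrpos /= (elimT max_idPr _).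
congr (- _)%E.
by apply: eq_esum => p /f0 fp; rewrite /funrneg /= (elimT max_idPl _)// oppr_ge0.
Qed.

(** * The balance identity and the cubic inequality *)

Lemma cubic_term_ge0 {R : realType} (x : nat -> R) (p : nat * nat) :
  nonneg_seq x -> pospair p ->
  0 <= kern R p.1 p.2 * x p.1 * x p.2 * x (p.1 + p.2)%N.
Proof.
move=> x0; case: p => a b [/= a0 b0]; have ab : (0 < a + b)%N by lia.
by rewrite /kern !mulr_ge0 ?x0.
Qed.

Definition cross {R : realType} (x : nat -> R) (k n : nat) : R :=
  (2 * n + k)%:R * (n%:R * x n) * ((n + k)%:R * x (n + k)%N).

Lemma cross_ge0 {R : realType} (x : nat -> R) (k n : nat) :
  nonneg_seq x -> (0 < n)%N -> 0 <= cross x k n.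
Proof.
move=> x0 n0; have n1 : (0 < n + k)%N by lia.
by rewrite /cross !mulr_ge0// x0.
Qed.

Lemma esum_pospair_swap {R : realType} (f : nat * nat -> \bar R) :
  (\esum_(p in pospair) f p = \esum_(p in pospair) f (p.2, p.1))%E.
Proof.
apply: (@reindex_esum _ _ _ pospair pospair (fun p => (p.2, p.1)) f).
split.
- by move=> [a b] [? ?].
- by move=> [a b] [c d] _ _ [-> ->].
- by move=> [a b] [? ?]; exists (b, a).
Qed.

(** The weight x_k cross_(k,n) is not symmetric in k and n, but its average with
    its mirror image is the summand of the cubic form. *)
Lemma seqC_cross {R : realType} (x : nat -> R) : nonneg_seq x ->
  (seqC x = \esum_(k in posn) ((x k)%:E * \esum_(n in posn) (cross x k n)%:E))%E.
Proof.
move=> x0.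
pose f (p : nat * nat) : R := x p.1 * cross x p.1 p.2.
have f0 p : pospair p -> (0 <= (f p)%:E)%E.
  by case=> p1 p2; rewrite lee_fin mulr_ge0 ?x0 ?cross_ge0.
transitivity (\esum_(p in pospair) (f p)%:E)%E; last first.
  transitivity (\esum_(k in posn) \esum_(n in posn) (f (k, n))%:E)%E.
    rewrite (@esum_esum _ _ _ posn (fun=> posn) (fun k n => (f (k, n))%:E)).
      by apply: eq_esum => -[].
    by move=> k n k0 n0; apply: f0.
  apply: eq_esum => k k0; rewrite -pos_esumZl ?x0//.
  by move=> n n0; rewrite lee_fin cross_ge0.
rewrite /seqC dsum_ge0; last by move=> p; exact: cubic_term_ge0.
(* Halving before splitting keeps all the sums nonnegative, so that they may be
   split even when infinite. *)
have h0 p : pospair p -> (0 <= (2^-1 * f p)%:E)%E.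
  by move=> pp; rewrite lee_fin mulr_ge0// -lee_fin f0.
transitivity (\esum_(p in pospair) ((2^-1 * f p)%:E + (2^-1 * f (p.2, p.1))%:E))%E.
  apply: eq_esum => -[a b] _; rewrite -EFinD; congr EFin.
  by rewrite /f /cross /kern /= [(b + a)%N]addnC !natrD !natrX !natrM; field.
rewrite esumD//; last by move=> [a b] [? ?]; apply: h0.
rewrite -(esum_pospair_swap (fun p => (2^-1 * f p)%:E)) -esumD//.
by apply: eq_esum => p _; rewrite -EFinD; congr EFin; lra.
Qed.

Definition e3term {R : realType} (x : nat -> R) (n : nat) : R := n%:R ^+ 3 * x n ^+ 2.

Definition sosterm {R : realType} (x : nat -> R) (k n : nat) : R :=
  (n%:R * x n - (n + k)%:R * x (n + k)%N)
  * (n%:R ^+ 2 * x n - (n + k)%:R ^+ 2 * x (n + k)%N).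

Lemma sosterm_cross {R : realType} (x : nat -> R) (k n : nat) :
  sosterm x k n + cross x k n = e3term x n + e3term x (n + k).
Proof. rewrite /sosterm /cross /e3term natrD natrD natrM; ring. Qed.

Section balance.
Context {R : realType} (x : nat -> R) (x0 : nonneg_seq x) (sx : star x).
Local Open Scope ereal_scope.

Lemma e3term_ge0 n : (0 <= e3term x n)%R.
Proof. exact: mulr_ge0 (exprn_ge0 _ (ler0n _ _)) (sqr_ge0 _). Qed.

Lemma sosterm_ge0 k n : (0 < n)%N -> (0 <= sosterm x k n)%R.
Proof. by move=> n0; rewrite sx//; lia. Qed.

Lemma seqE3E : seqE3 x = \esum_(n in posn) (e3term x n)%:E.
Proof. by rewrite -pos_esum// => n _; rewrite lee_fin e3term_ge0. Qed.

(** The sum of squares, the head and the cross sum make up two copies of E_3: the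
    head restores the first k terms lost by the copy shifted by k. *)
Lemma sosQ_cross k :
  sosQ x k + \esum_(n in posn) (cross x k n)%:E = seqE3 x + seqE3 x.
Proof.
have e0 n : 0 <= (e3term x n)%:E by rewrite lee_fin e3term_ge0.
have sos0 n : posn n -> 0 <= (sosterm x k n)%:E.
  by move=> n0; rewrite lee_fin sosterm_ge0.
have cr0 n : posn n -> 0 <= (cross x k n)%:E.
  by move=> n0; rewrite lee_fin cross_ge0.
rewrite /sosQ pos_esum// addeAC -esumD//.
under eq_esum do rewrite -EFinD sosterm_cross EFinD.
rewrite esumD//.
rewrite -addeA [X in _ + X]addeC -pos_esum_split ?seqE3E//.
Qed.

Lemma sosQ_ge0 k : 0 <= sosQ x k.
Proof.
rewrite /sosQ adde_ge0//.
  by apply: nneseries_ge0 => n n0 _; rewrite lee_fin sosterm_ge0.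
by apply: sume_ge0 => n _; rewrite lee_fin e3term_ge0.
Qed.

Lemma cross_le k : \esum_(n in posn) (cross x k n)%:E <= 2%:E * seqE3 x.
Proof. by rewrite mule_natl mule2n -(sosQ_cross k) leeDr ?sosQ_ge0. Qed.

(** Finiteness of E_3 makes the cross sum finite, so that it can be subtracted
    from the balance identity. *)
Lemma seqQ_sosQ k : seqE3 x < +oo -> seqQ x k = sosQ x k.
Proof.
move=> E3fin; rewrite /seqQ.
under eq_eseriesr do rewrite exprMn mulrA -exprS.
rewrite -/(seqE3 x) mule_natl mule2n -(sosQ_cross k) pos_esum; last first.
  by move=> n n0; rewrite lee_fin cross_ge0.
rewrite addeK// ge0_fin_numE; last first.
  by apply: esum_ge0 => n n0; rewrite lee_fin cross_ge0.
apply: le_lt_trans (cross_le k) _.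
by rewrite lte_mul_pinfty// lee_fin.
Qed.

Lemma seqC_le : seqA x < +oo -> seqE3 x < +oo ->
  seqC x <= 2%:E * seqA x * seqE3 x.
Proof.
move=> Afin E3fin.
have xe n : (0 < n)%N -> 0 <= (x n)%:E by move=> n0; rewrite lee_fin x0.
have E30 : 0 <= seqE3 x by rewrite seqE3E esum_ge0// => n _; rewrite lee_fin e3term_ge0.
have E3n : seqE3 x \is a fin_num by rewrite ge0_fin_numE.
rewrite seqC_cross// muleC muleA [seqE3 x * _]muleC -(fineK E3n) -EFinM /seqA.
rewrite pos_esum// -pos_esumZl//; last by rewrite mulr_ge0 ?fine_ge0.
apply: le_esum => k k0; rewrite muleC lee_wpmul2r ?xe//.
by rewrite EFinM fineK ?cross_le.
Qed.

End balance.

(** * Monotone sequences, finite support and the strong bracket *)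

(** If n^2 x_n is nonincreasing, so is n x_n, being n^2 x_n divided by n; the
    two factors in (star) then have the same sign. *)
Lemma star_of_decreasing {R : realType} (x : nat -> R) : nonneg_seq x ->
  (forall n : nat, (0 < n)%N -> n.+1%:R ^+ 2 * x n.+1 <= n%:R ^+ 2 * x n) ->
  star x.
Proof.
move=> x0 dx.
have mono m n : (0 < m)%N -> (m <= n)%N -> n%:R ^+ 2 * x n <= m%:R ^+ 2 * x m.
  move=> m0; elim: n => [|n IH]; first by lia.
  rewrite leq_eqVlt => /predU1P[<-//|mn].
  by apply: le_trans (dx n _) (IH _); lia.
have ord m n : (0 < m)%N -> (m <= n)%N ->
    0 <= (n%:R * x n - m%:R * x m) * (n%:R ^+ 2 * x n - m%:R ^+ 2 * x m).
  move=> m0 mn; have h2 := mono m n m0 mn.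
  have n0 : 0 < n%:R :> R by rewrite ltr0n; lia.
  have h1 : n%:R * x n <= m%:R * x m.
    rewrite -(ler_pM2l n0); apply: le_trans (_ : m%:R * (m%:R * x m) <= _).
      by rewrite !mulrA -!expr2.
    by rewrite ler_wpM2r ?ler_nat// mulr_ge0 ?x0.
  by apply: mulr_le0; rewrite subr_le0.
move=> m n m0 n0; case: (leqP m n) => [mn|/ltnW nm]; first exact: ord.
by rewrite -mulrNN !opprB ord.
Qed.

Lemma finite_support_fin {R : realType} (x : nat -> R) :
  nonneg_seq x -> finitely_supported x ->
  (seqA x < +oo)%E /\ (seqE3 x < +oo)%E.
Proof.
move=> x0 [N xN]; split.
  by rewrite /seqA (eseries1_finite_support _ N) ?ltry// => n /ltnW; exact: xN.
rewrite /seqE3 (eseries1_finite_support _ N) ?ltry// => n.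
  by move=> _; exact: e3term_ge0.
by move=> /ltnW/xN ->; rewrite expr0n mulr0.
Qed.

(** Each triple product of coefficients -x_n contributes one overall sign, which
    turns the cubic part of the bracket into -C(x). *)
Lemma anticoherent_bracket {R : realType} (x : nat -> R) (m : R) (r : int -> R[i]) :
  nonneg_seq x -> anticoherent m x r ->
  strong_bracket r = ((8 * pi)%:E * (m%:E * seqE3 x - seqC x))%E.
Proof.
move=> x0 [_ r0 rx]; rewrite /strong_bracket r0 /=.
congr (_ * (_ * _ + _))%E.
  rewrite seqE3E pos_esum; last first.
    by move=> n _; rewrite lee_fin; apply: mulr_ge0 (exprn_ge0 _ (ler0n _ _)) (sqr_ge0 _).
  apply: eq_esum => n n0; rewrite rx//; congr (_ * _)%:E.
  by rewrite /ComplexField.Normc.normc /= expr0n addr0 sqr_sqrtr ?sqr_ge0 ?sqrrN.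
have triple p : pospair p ->
  kern R p.1 p.2 * complex.Re (r p.1%:Z * r p.2%:Z * conjc (r (p.1 + p.2)%N%:Z))
  = - (kern R p.1 p.2 * x p.1 * x p.2 * x (p.1 + p.2)%N).
  case: p => a b [/= a0 b0]; rewrite !rx//=; last by lia.
  ring.
rewrite dsum_le0 => [|p pp]; last by rewrite triple// oppr_le0 cubic_term_ge0.
congr (- _)%E; rewrite /seqC !dsum_ge0//.
- by apply: eq_esum => p pp; rewrite triple// opprK.
- by move=> p; exact: cubic_term_ge0.
- by move=> p pp; rewrite triple// opprK cubic_term_ge0.
Qed.

(** * Sharpness: the truncated inverse squares *)

Definition harm (R : realType) (N : nat) : R := \sum_(1 <= n < N.+1) n%:R^-1.

Lemma harmS (R : realType) N : harm R N.+1 = harm R N + N.+1%:R^-1.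
Proof. by rewrite /harm big_nat_recr. Qed.

Lemma harm_unbounded (R : realType) (B : R) : exists N, B < harm R N.
Proof.
apply: contrapT => /forallNP hB; apply: (@dvg_harmonic R).
apply: nondecreasing_is_cvgn.
  by apply/nondecreasing_seqP => n; rewrite seriesSr lerDl harmonic_ge0.
exists B => _ [n _ <-]; have /negP := hB n; rewrite -leNgt; apply: le_trans.
by rewrite /harm seriesEnat /= big_add1.
Qed.

(** Telescoping: the difference of (H_k + 2) / k between k and k + 1 dominates
    H_(k+1) / (k+1)^2. *)
Lemma sum_harm_sqr_le (R : realType) N :
  \sum_(1 <= k < N.+1) (k%:R ^+ 2)^-1 * harm R k <= 4 :> R.
Proof.
case: N => [|N]; first by rewrite big_geq.
(* The numerator H + 2 leaves room for the step, and 4 makes the case of a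
   single term an equality. *)
suff: \sum_(1 <= k < N.+2) (k%:R ^+ 2)^-1 * harm R k
      <= 4 - (harm R N.+1 + 2) / N.+1%:R.
  move=> /le_trans; apply; rewrite gerBl divr_ge0// addr_ge0//.
  by apply: sumr_ge0 => n _; rewrite invr_ge0.
elim: N => [|N IH].
  by rewrite big_nat1 harmS /harm big_geq//; lra.
rewrite big_nat_recr//=; apply: le_trans (lerD IH (lexx _)) _.
rewrite [harm R N.+2]harmS -[N.+2%:R]natr1.
set h := harm R N.+1; have : 0 < N.+1%:R :> R by [].
have : 0 <= h by apply: sumr_ge0 => n _; rewrite invr_ge0.
move: h N.+1%:R => h t h0 t0.
rewrite -subr_ge0.
have -> : 4 - (h + (t + 1)^-1 + 2) / (t + 1) -
  (4 - (h + 2) / t + ((t + 1) ^+ 2)^-1 * (h + (t + 1)^-1)) =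
  (h * (t + 1) + t ^+ 2 + 2 * t + 2) / (t * (t + 1) ^+ 3).
  by field; apply/andP; split; lra.
rewrite divr_ge0//; first by rewrite !addr_ge0 ?mulr_ge0 ?sqr_ge0//; lra.
by rewrite mulr_ge0 ?exprn_ge0//; lra.
Qed.

Definition invsq (R : realType) (N n : nat) : R :=
  if (n <= N)%N then (n%:R ^+ 2)^-1 else 0.

Lemma invsq_nonneg (R : realType) N : nonneg_seq (invsq R N).
Proof. by move=> n _; rewrite /invsq; case: ifP => // _; rewrite invr_ge0 exprn_ge0. Qed.

Lemma invsq_supp (R : realType) N n : (N < n)%N -> invsq R N n = 0.
Proof. by move=> nN; rewrite /invsq leqNgt nN. Qed.

Lemma invsq_star (R : realType) N : star (invsq R N).
Proof.
apply: star_of_decreasing; first exact: invsq_nonneg.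
move=> n n0; rewrite /invsq; case: (ltnP n N) => nN; last first.
  by rewrite mulr0; case: ifP => _; rewrite ?mulr0// mulr_ge0 ?invr_ge0 ?exprn_ge0.
by rewrite (ltnW nN) !divff// expf_eq0 /= pnatr_eq0; lia.
Qed.

Lemma invsq_seqA (R : realType) N :
  (seqA (invsq R N) = (\sum_(1 <= n < N.+1) (n%:R ^+ 2)^-1)%:E)%E.
Proof.
rewrite /seqA (eseries1_finite_support _ N).
- by congr EFin; apply: eq_big_nat => n /andP[_ nN]; rewrite /invsq -ltnS nN.
- exact: invsq_nonneg.
- exact: invsq_supp.
Qed.

Lemma invsq_seqE3 (R : realType) N : (seqE3 (invsq R N) = (harm R N)%:E)%E.
Proof.
rewrite /seqE3 (eseries1_finite_support _ N).
- congr EFin; apply: eq_big_nat => n /andP[n0 nN]; rewrite /invsq -ltnS nN.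
  by field; rewrite pnatr_eq0; lia.
- by move=> n _; exact: e3term_ge0.
- by move=> n nN; rewrite invsq_supp// expr0n mulr0.
Qed.

(** From (2n+k) / (n (n+k)) >= 2 / (n+k), summed over n <= N - k. *)
Lemma invsq_cross_ge (R : realType) N k : (0 < k <= N)%N ->
  ((2 * (harm R N - harm R k))%:E
    <= \esum_(n in posn) (cross (invsq R N) k n)%:E)%E.
Proof.
move=> /andP[k0 kN].
have c0 n : (0 < n)%N -> 0 <= cross (invsq R N) k n.
  by move=> n0; rewrite cross_ge0//; exact: invsq_nonneg.
rewrite -pos_esum//.
apply: le_trans (@nneseries_lim_ge _ _ xpredT _ (N - k).+1 _); last first.
  by move=> n n0 _; rewrite lee_fin c0.
rewrite sumEFin lee_fin.
have -> : harm R N - harm R k = \sum_(1 <= n < (N - k).+1) (n + k)%:R^-1.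
  rewrite /harm (@big_cat_nat _ _ _ k.+1 1 N.+1)//= addrAC subrr add0r.
  by rewrite -[k.+1]add1n big_addn subSn.
rewrite mulr_sumr; apply: ler_sum_nat => n /andP[n0 nN].
rewrite /cross /invsq !ifT; [|lia..].
have nR : 0 < n%:R :> R by rewrite ltr0n.
have kR : 0 < k%:R :> R by rewrite ltr0n.
rewrite natrD natrD natrM; move: (n%:R) (k%:R) nR kR => a b a0 b0.
rewrite -subr_ge0.
have -> : (2 * a + b) * (a * (a ^+ 2)^-1) * ((a + b) * ((a + b) ^+ 2)^-1) - 2 * (a + b)^-1
   = b / (a * (a + b)) by field; apply/andP; split; lra.
by rewrite divr_ge0 ?mulr_ge0//; lra.
Qed.

(** The deficit in the bound C(x) <= 2 A E_3 is at most 8 for every N, while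
    A E_3 grows like H_N. *)
Lemma invsq_seqC_ge (R : realType) N :
  ((2 * (\sum_(1 <= n < N.+1) (n%:R ^+ 2)^-1) * harm R N - 8)%:E
    <= seqC (invsq R N))%E.
Proof.
have x0 := @invsq_nonneg R N.
have cr0 k : (0 <= \esum_(n in posn) (cross (invsq R N) k n)%:E)%E.
  by apply: esum_ge0 => n n0; rewrite lee_fin cross_ge0.
rewrite seqC_cross// -pos_esum => [|k k0]; last by rewrite mule_ge0// lee_fin x0.
apply: le_trans (@nneseries_lim_ge _ _ xpredT _ N.+1 _); last first.
  by move=> k k0 _; rewrite mule_ge0// lee_fin x0.
apply: (@le_trans _ _
  (\sum_(1 <= k < N.+1) ((k%:R ^+ 2)^-1 * (2 * (harm R N - harm R k)))%:E)%E).
  rewrite sumEFin lee_fin.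
  under [leRHS]eq_bigr do rewrite mulrCA mulrBr mulrBr.
  rewrite sumrB -!mulr_sumr -mulr_suml -mulrA lerB//.
  by have := sum_harm_sqr_le R N; lra.
rewrite big_nat_cond [leRHS]big_nat_cond; apply: lee_sum => k /andP[/andP[k0 kN] _].
rewrite EFinM /invsq -ltnS kN lee_wpmul2l ?lee_fin ?invr_ge0 ?exprn_ge0//.
by apply: invsq_cross_ge; rewrite k0.
Qed.

(** As A >= 1, the deficit 8 is smaller than (2 - c) A H_N as soon as
    H_N > 8 / (2 - c). *)
Lemma constant_two_sharp {R : realType} (c : R) : c < 2 ->
  exists x : nat -> R,
    [/\ nonneg_seq x, finitely_supported x, star x &
        (c%:E * seqA x * seqE3 x < seqC x)%E].
Proof.
move=> c2; have [N hN] := harm_unbounded R (8 / (2 - c)).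
have h0 : 0 < harm R N by apply: le_lt_trans hN; rewrite divr_ge0//; lra.
exists (invsq R N); split.
- exact: invsq_nonneg.
- by exists N.+1 => n; exact: invsq_supp.
- exact: invsq_star.
rewrite invsq_seqA invsq_seqE3 -!EFinM.
apply: lt_le_trans (invsq_seqC_ge R N); rewrite lte_fin.
have A1 : 1 <= \sum_(1 <= n < N.+1) (n%:R ^+ 2)^-1 :> R.
  case: N h0 {hN} => [|N _]; first by rewrite /harm big_geq// ltxx.
  by rewrite big_ltn// expr1n invr1 lerDl sumr_ge0// => n _; rewrite invr_ge0 exprn_ge0.
move: hN; rewrite ltr_pdivrMr; last by lra.
by nra.
Qed.

Theorem theorem3p8 (R : realType) :
  [/\ (* sufficient condition for (star) *)
      forall x : nat -> R, nonneg_seq x ->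
        (forall n : nat, (0 < n)%N ->
           n.+1%:R ^+ 2 * x n.+1 <= n%:R ^+ 2 * x n) ->
        star x,
      (* finitely supported sequences *)
      forall x : nat -> R, nonneg_seq x -> finitely_supported x -> star x ->
        (seqC x <= 2%:E * seqA x * seqE3 x)%E /\
        forall k : nat, (0 < k)%N -> seqQ x k = sosQ x k /\ (0 <= sosQ x k)%E,
      (* infinite sequences *)
      forall x : nat -> R, nonneg_seq x -> star x ->
        (seqA x < +oo)%E -> (seqE3 x < +oo)%E ->
        (seqC x <= 2%:E * seqA x * seqE3 x)%E /\
        forall k : nat, (0 < k)%N -> seqQ x k = sosQ x k /\ (0 <= sosQ x k)%E,
      (* the constant 2 is sharp *)
      forall c : R, c < 2 ->
        exists x : nat -> R,
          [/\ nonneg_seq x, finitely_supported x, star x &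
              (c%:E * seqA x * seqE3 x < seqC x)%E]
    & (* strong bracket of the fully anticoherent spectrum *)
      forall x : nat -> R, nonneg_seq x -> star x ->
        (seqA x < +oo)%E -> (seqE3 x < +oo)%E ->
        forall (m : R) (r : int -> R[i]), (2%:E * seqA x <= m%:E)%E ->
          anticoherent m x r -> (0 <= strong_bracket r)%E].
Proof.
have infinite (x : nat -> R) : nonneg_seq x -> star x ->
    (seqA x < +oo)%E -> (seqE3 x < +oo)%E ->
    (seqC x <= 2%:E * seqA x * seqE3 x)%E /\
    forall k : nat, (0 < k)%N -> seqQ x k = sosQ x k /\ (0 <= sosQ x k)%E.
  move=> x0 sx Afin E3fin; split; first exact: seqC_le.
  by move=> k _; split; [exact: seqQ_sosQ|exact: sosQ_ge0].
split=> //.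
- exact: star_of_decreasing.
- move=> x x0 /(finite_support_fin x x0)[Afin E3fin] sx; exact: infinite.
- exact: constant_two_sharp.
- move=> x x0 sx Afin E3fin m r Am rx.
  have E30 : (0 <= seqE3 x)%E.
    by apply: nneseries_ge0 => n _ _; rewrite lee_fin e3term_ge0.
  have E3n : seqE3 x \is a fin_num by rewrite ge0_fin_numE.
  rewrite (anticoherent_bracket x m r x0 rx) mule_ge0 ?lee_fin ?mulr_ge0 ?pi_ge0//.
  rewrite sube_ge0 ?fin_numM ?orbT//.
  by apply: le_trans (seqC_le x x0 sx Afin E3fin) _; rewrite lee_wpmul2r.
Qed.
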